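(* Let $A$ be a $C^*$-algebra and $E$ a Hilbert $A$-module. Let $T$ be a regular self-adjoint operator on $E$, and let $R$ be a symmetric operator on $E$ which is relatively $T$-compact. Then $T+R$ is also regular and self-adjoint on $\operatorname{Dom}(T+R)=\operatorname{Dom}(T)$.
   Context: A densely defined operator $S$ on $E$ is regular if it is closed, $S^*$ is densely defined, and $1+S^*S$ has dense range. For $T$ regular self-adjoint, a densely defined operator $R$ on $E$ is relatively $T$-compact if $\operatorname{Dom}(T)\subset\operatorname{Dom}(R)$ and $R(T\pm i)^{-1}$ is compact, i.e. lies in $\mathcal K_A(E)$, the norm closure of the span of the rank-one operators $\theta_{\psi,\eta}\xi=\psi\langle\eta|\xi\rangle$. *)

(* Defs.v *)
From HB Require Import structures.
From mathcomp Require Import all_boot all_order all_algebra.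
From mathcomp Require Import complex.
From mathcomp Require Import boolp classical_sets reals topology normedtype.

Set Implicit Arguments.
Unset Strict Implicit.
Unset Printing Implicit Defensive.

Import Order.TTheory GRing.Theory Num.Theory.

Local Open Scope classical_set_scope.
Local Open Scope ring_scope.

(* The multiplication is part of the mixin rather than inherited from the
   library's rings because A need not be unital.                             *)
HB.mixin Record CompleteNormedModule_isCstarAlgebra (R : realType) A
    & CompleteNormedModule R[i] A := {
  cmul : A -> A -> A;
  cstar : A -> A;
  cmulA : associative cmul;
  cmulDl : left_distributive cmul +%R;
  cmulDr : right_distributive cmul +%R;
  cmulZl : forall (c : R[i]) (a b : A), cmul (c *: a) b = c *: cmul a b;
  cmulZr : forall (c : R[i]) (a b : A), cmul a (c *: b) = c *: cmul a b;
  cstarK : involutive cstar;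
  cstarD : {morph cstar : a b / a + b};
  cstarZ : forall (c : R[i]) (a : A), cstar (c *: a) = c^* *: cstar a;
  cstarM : forall a b : A, cstar (cmul a b) = cmul (cstar b) (cstar a);
  cnormM : forall a b : A, `|cmul a b| <= `|a| * `|b|;
  cnorm_star : forall a : A, `|cmul (cstar a) a| = `|a| ^+ 2
}.

#[short(type="cstarAlgType")]
HB.structure Definition CstarAlgebra (R : realType) :=
  {A of CompleteNormedModule_isCstarAlgebra R A & CompleteNormedModule R[i] A}.

Definition cpositive (R : realType) (A : cstarAlgType R) (a : A) : Prop :=
  exists b : A, a = cmul (cstar b) b.

(* Right modules, with inner product linear in its second argument. The norm
   is the one the inner product induces (ip_norm), which also gives
   definiteness of the inner product and, with CompleteNormedModule, the
   completeness of E in that norm.                                           *)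
HB.mixin Record CompleteNormedModule_isHilbertModule (R : realType)
    (A : cstarAlgType R) E & CompleteNormedModule R[i] E := {
  act : E -> A -> E;
  ip : E -> E -> A;
  actDl : forall (x y : E) (a : A), act (x + y) a = act x a + act y a;
  actDr : forall (x : E) (a b : A), act x (a + b) = act x a + act x b;
  actM : forall (x : E) (a b : A), act x (cmul a b) = act (act x a) b;
  actZl : forall (c : R[i]) (x : E) (a : A), act (c *: x) a = c *: act x a;
  actZr : forall (c : R[i]) (x : E) (a : A), act x (c *: a) = c *: act x a;
  ipDr : forall x y z : E, ip x (y + z) = ip x y + ip x z;
  ipZr : forall (c : R[i]) (x y : E), ip x (c *: y) = c *: ip x y;
  ip_actr : forall (x y : E) (a : A), ip x (act y a) = cmul (ip x y) a;
  ip_star : forall x y : E, cstar (ip x y) = ip y x;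
  ip_ge0 : forall x : E, cpositive (ip x x);
  ip_norm : forall x : E, `|x| ^+ 2 = `|ip x x|
}.

#[short(type="hilbertModType")]
HB.structure Definition HilbertModule (R : realType) (A : cstarAlgType R) :=
  {E of CompleteNormedModule_isHilbertModule R A E
      & CompleteNormedModule R[i] E}.

(* A partially defined map on E; the values of app outside dom are junk. *)
Record operator (E : Type) := Operator { dom : set E; app :> E -> E }.

Definition eqop (E : Type) (S T : operator E) : Prop :=
  dom S = dom T /\ forall x, dom S x -> S x = T x.

Definition op_range (E : Type) (S : operator E) : set E := S @` dom S.

Definition comp_op (E : Type) (S T : operator E) : operator E :=
  Operator [set x | dom T x /\ dom S (T x)] (S \o T).

Section HilbertModuleOperators.
Variables (R : realType) (A : cstarAlgType R) (E : hilbertModType A).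
Implicit Types S T : operator E.


Definition scalar_op (c : R[i]) : operator E := Operator setT (fun x => c *: x).

Definition add_op S T : operator E :=
  Operator (dom S `&` dom T) (fun x => S x + T x).

(* The inverse of an injective operator, defined on its range. *)
Definition inv_op S : operator E :=
  Operator (op_range S) (fun y => xget 0 [set x | dom S x /\ S x = y]).

(* When dom S is dense, the z in the domain condition is unique. *)
Definition adjoint_rel S (y z : E) : Prop :=
  forall x, dom S x -> ip (S x) y = ip x z.

Definition adjoint S : operator E :=
  Operator [set y | exists z, adjoint_rel S y z]
           (fun y => xget 0 [set z | adjoint_rel S y z]).

Definition A_linear_op S : Prop :=
  [/\ dom S 0,
      forall (c : R[i]) x y, dom S x -> dom S y ->
        dom S (c *: x + y) /\ S (c *: x + y) = c *: S x + S y
    & forall x (a : A), dom S x ->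
        dom S (act x a) /\ S (act x a) = act (S x) a].

Definition densely_defined S : Prop := A_linear_op S /\ dense (dom S).

Definition closed_op S : Prop :=
  closed ([set (x, S x) | x in dom S] : set (E * E)).

Definition symmetric_op S : Prop :=
  densely_defined S /\
  forall x y, dom S x -> dom S y -> ip (S x) y = ip x (S y).

Definition self_adjoint S : Prop := densely_defined S /\ eqop S (adjoint S).

Definition regular S : Prop :=
  [/\ densely_defined S,
      closed_op S,
      dense (dom (adjoint S))
    & dense (op_range (add_op (scalar_op 1) (comp_op (adjoint S) S)))].

Definition theta (psi eta : E) : E -> E := fun xi => act psi (ip eta xi).

Definition theta_span (F : E -> E) : Prop :=
  exists (n : nat) (c : 'I_n -> R[i]) (psi eta : 'I_n -> E),
    forall xi, F xi = \sum_(i < n) c i *: theta (psi i) (eta i) xi.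

(* Closure in operator norm: ||K - F|| <= e is spelled out pointwise.
   For e : R[i], 0 < e entails that e is real. *)
Definition compact_map (K : E -> E) : Prop :=
  forall e : R[i], 0 < e -> exists2 F : E -> E, theta_span F &
    forall x, `|K x - F x| <= e * `|x|.

Definition compact_op S : Prop := dom S = setT /\ compact_map S.

Definition relatively_compact T S : Prop :=
  [/\ densely_defined S,
      dom T `<=` dom S,
      compact_op (comp_op S (inv_op (add_op T (scalar_op 'i))))
    & compact_op (comp_op S (inv_op (add_op T (scalar_op (- 'i)))))].

End HilbertModuleOperators.

(* Main.v *)
Require Import Defs.
From HB Require Import structures.
From mathcomp Require Import all_boot all_order all_algebra.
From mathcomp Require Import complex.
From mathcomp Require Import boolp classical_sets reals topology normedtype.
From mathcomp Require Import ring.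

(* For symmetric H and purely imaginary c the identity |Hx + cx| = |Hx - cx|
   and the triangle inequality bound both |c||x| and |Hx| by |Hx + cx|. Hence
   surjectivity of H + c survives perturbations of relative bound 1/2, and in
   particular propagates along the ray of positive multiples of c. Regularity
   and self-adjointness make T + i and T - i onto, hence T + imu and T - imu for
   mu = 1 + n/2; relative compactness makes S small relative to T + imu as
   mu grows: approximate S by a finite-rank F after T + i, and move T + i to the
   other side of the inner products <eta, (T + i)x>, with eta replaced by a
   nearby vector of Dom(T). So T + S + imu and T + S - imu are onto, hence
   T + S + i and T + S - i, which for a symmetric operator gives both
   conclusions. *)

Set Implicit Arguments.
Unset Strict Implicit.
Unset Printing Implicit Defensive.

Import Order.TTheory GRing.Theory Num.Theory.

Local Open Scope classical_set_scope.
Local Open Scope ring_scope.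

(** * Archimedean bounds in [R[i]] *)

Lemma complex_archimedean (R : realType) (b : R[i]) :
  \forall n \near \oo, `|b| <= 1 + n%:R / 2.
Proof.
case: b => u v; rewrite normc_def /=; set r := Num.sqrt _.
have : \forall n \near \oo, 2 * r <= n%:R by exact: nbhs_infty_ger.
apply: filterS => n rn.
have -> : 1 + n%:R / 2 = (1 + n%:R / 2 : R)%:C%C.
  by rewrite rmorphD rmorphM fmorphV !rmorph_nat rmorph1.
rewrite lecR; apply: (@le_trans _ _ (n%:R / 2)); last by rewrite lerDr.
by rewrite ler_pdivlMr// mulrC.
Qed.

Lemma complex_bound (R : realType) (b : R[i]) : exists n : nat, `|b| <= n%:R.
Proof.
have [n bn] := filter_ex (complex_archimedean b).
exists n.+1; apply: le_trans bn _.
by rewrite -[n.+1%:R]natr1 addrC lerD2r ler_piMr// invf_le1// ler1n.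
Qed.

(** * Density, completeness and perturbation of surjections in normed spaces *)

Section NormedSpace.
Context {K : numFieldType} {E : completeNormedModType K}.
Implicit Types (e : K) (x y : E).

Lemma dense_normP (D : set E) :
  dense D <-> forall x e, 0 < e -> exists2 y, D y & `|x - y| < e.
Proof.
split=> [dD x e e0|dD O [x Ox] oO].
  have [] := dD (ball x e)°; last first.
  - move=> y [/interior_subset xy Dy]; exists y => //.
    by move: xy; rewrite -ball_normE.
  - exact: open_interior.
  - by exists x; apply: nbhsx_ballx.
have /nbhs_ballP[e /= e0 xeO] : nbhs x O by apply: open_nbhs_nbhs.
have [y Dy xy] := dD x e e0.
by exists y; split=> //; apply: xeO; rewrite -ball_normE.
Qed.

(** Completeness phrased for sets [D e] of approximate solutions: they form the base of a Cauchy
    filter, whose limit is [l]. *)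
Lemma approx_limit (D : K -> set E) :
    (forall d e, d <= e -> D d `<=` D e) ->
    (forall e, 0 < e -> D e !=set0) ->
    (forall e x y, 0 < e -> D e x -> D e y -> `|x - y| < e) ->
  exists l, forall e, 0 < e -> exists2 x, D e x & `|l - x| < e.
Proof.
move=> mono ne diam.
pose F := filter_from [set e : K | 0 < e] D.
have FF : ProperFilter F.
  apply: filter_from_proper ne; apply: filter_from_filter.
    by exists 1; exact: ltr01.
  move=> d e d0 e0; have de : d >=< e by rewrite real_comparable// gtr0_real.
  exists (Num.min d e); first by rewrite /= comparable_lt_min// d0 e0.
  move=> x Dx; split; apply: mono Dx.
    by rewrite comparable_ge_min// lexx.
  by rewrite comparable_ge_min// lexx orbT.
have FC : cauchy F.
  apply/cauchy_ballP => e e0; exists (D e, D e); first by split; exists e.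
  by move=> [x y] /= [Dx Dy]; rewrite -ball_normE; apply: diam Dx Dy.
have /cauchy_cvgP/cvg_ex/=[l Fl] := FC.
exists l => e e0.
have Fe : F (D e) by exists e.
have Fle : F [set x | `|l - x| < e] by move/fcvgrPdist_lt: Fl; apply.
by have [x [Dx lx]] := filter_ex (filterI Fe Fle); exists x.
Qed.

Lemma le0_of_lt_mul (a b : K) : 0 < b -> (forall e, 0 < e -> a < e * b) -> a <= 0.
Proof.
move=> b0 ab.
(* The order on [K] is partial, so [a] is first shown to be real: [a - b] is negative and [b] is
   positive. *)
have ar : a \is Num.real.
  have h := ab 1 ltr01; rewrite -[a](subrK (1 * b)) rpredD//.
    by apply: ltr0_real; rewrite subr_lt0.
  by rewrite mul1r gtr0_real.
rewrite real_leNgt// ?real0//; apply/negP => a0.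
have := ab (a / b) (divr_gt0 a0 b0).
by rewrite divfK ?gt_eqF// ltxx.
Qed.

Lemma eq0_of_norm_lt_mul (V : normedZmodType K) (x : V) (b : K) : 0 < b ->
  (forall e, 0 < e -> `|x| < e * b) -> x = 0.
Proof.
by move=> b0 /(le0_of_lt_mul b0); rewrite normr_le0 => /eqP.
Qed.

Lemma half_contraction_fixpoint (f : E -> E) :
    (forall b : K, exists n : nat, `|b| <= n%:R) ->
    (forall x y, `|f x - f y| <= 2^-1 * `|x - y|) ->
  exists x, f x = x.
Proof.
move=> arch ctr.
(* For two such points the contraction gives [|x - y| / 2 <= |f x - x| + |f y - y| < e / 2]. *)
pose D (e : K) := [set x | `|f x - x| < e / 4].
have [|||l lD] := @approx_limit D.
- by move=> d e de x; rewrite /D /= => /lt_le_trans; apply; rewrite ler_wpM2r// invr_ge0.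
(* Since [n < 2 ^ n], this linear bound suffices for the geometric decay along the iterates of 0. *)
- move=> e e0; have [n ne] := arch (4 * `|f 0 - 0| / e).
  have step k : `|f (iter k f 0) - iter k f 0| <= 2^-1 ^+ k * `|f 0 - 0|.
    elim: k => [|k IH]; first by rewrite mul1r.
    apply: le_trans (ctr _ _) _; rewrite exprS -mulrA.
    by rewrite ler_wpM2l// invr_ge0.
  exists (iter n f 0); apply: (le_lt_trans (step n)).
  rewrite exprVn mulrC ltr_pdivrMr ?exprn_gt0//.
  move: ne; rewrite ger0_norm; last first.
    by rewrite !mulr_ge0// invr_ge0 ltW.
  rewrite ler_pdivrMr// => ne.
  rewrite -(@ltr_pM2l _ 4)// (le_lt_trans ne)//.
  have -> : 4 * (e / 4 * 2 ^+ n) = 2 ^+ n * e by field.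
  rewrite ltr_pM2r//.
  by rewrite -natrX ltr_nat ltn_expl.
- move=> e x y e0; rewrite /D /= => fx fy.
  have : `|x - y| <= `|f x - x| + 2^-1 * `|x - y| + `|f y - y|.
    have {1}-> : x - y = - (f x - x) + (f x - f y) + (f y - y).
      by rewrite opprB !subrKA.
    apply: le_trans (ler_normD _ _) _; rewrite lerD2r.
    by apply: le_trans (ler_normD _ _) _; rewrite normrN lerD2l ctr.
  rewrite -addrA addrCA -lerBlDl.
  have -> : `|x - y| - 2^-1 * `|x - y| = `|x - y| / 2 by field.
  move=> /le_lt_trans /(_ (ltrD fx fy)).
  by rewrite (_ : e / 4 + e / 4 = e / 2) ?ltr_pM2r ?invr_gt0//; field.
- exists l; apply/subr0_eq; apply: (@eq0_of_norm_lt_mul _ _ 2) => // e e0.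
  have [x fx lx] := lD e e0.
  have -> : f l - l = (f l - f x) + (f x - x) - (l - x).
    by rewrite opprB !subrKA.
  have -> : e * 2 = e / 2 + e / 4 + e / 4 + e by field.
  apply: le_lt_trans (ler_normB _ _) _; rewrite ltrD//.
  apply: le_lt_trans (ler_normD _ _) _; rewrite -addrA ltr_leD//.
    by apply: le_lt_trans (ctr _ _) _; rewrite mulrC ltr_pM2r ?invr_gt0.
  by rewrite ltW// (lt_trans fx)// ltrDl divr_gt0.
Qed.

(** For any right inverse [g] of [G], additive or not, [z |-> y - P (g z)] contracts by 1/2, because
    [P] is bounded by [G / 2] on the difference [g z - g z']. A fixed point [z] yields the solution
    [g z]. *)
Lemma surjective_perturbation (D : set E) (G P : E -> E) :
    (forall b : K, exists n : nat, `|b| <= n%:R) ->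
    (forall x y, D x -> D y ->
      [/\ D (x - y), G (x - y) = G x - G y & P (x - y) = P x - P y]) ->
    (forall x, D x -> `|P x| <= 2^-1 * `|G x|) ->
    (forall y, exists2 x, D x & G x = y) ->
  forall y, exists2 x, D x & G x + P x = y.
Proof.
move=> arch DB PG onto y.
have /choice[g gP] z : exists x, D x /\ G x = z.
  by have [x ? ?] := onto z; exists x.
have [z fz] : exists z, y - P (g z) = z.
  apply: (@half_contraction_fixpoint (fun z => y - P (g z))) => // z z'.
  have [[Dz Gz] [Dz' Gz']] := (gP z, gP z').
  have [Db Gb Pb] := DB _ _ Dz Dz'.
  have -> : y - P (g z) - (y - P (g z')) = - P (g z - g z').
    by rewrite Pb opprB addrC addrA subrK opprB addrC.
  by rewrite normrN (le_trans (PG _ Db))// Gb Gz Gz'.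
by exists (g z); [exact: (gP z).1|rewrite (gP z).2 -{1}fz subrK].
Qed.
End NormedSpace.

(** * Norm inequalities in a Hilbert module *)

Section HilbertModule.
Context {R : realType} {A : cstarAlgType R} {E : hilbertModType A}.
Implicit Types (x y z : E) (c : R[i]) (S T H : operator E).

(** The C*-identity and submultiplicativity give [|b|^2 <= |b^*| |b|]; the involution supplies the
    reverse inequality. *)
Lemma cnormJ (a : A) : `|cstar a| = `|a|.
Proof.
suff le (b : A) : `|b| <= `|cstar b|.
  by apply: le_anti; rewrite le -{2}[a]cstarK le.
have [->|b0] := eqVneq b 0; first by rewrite normr0.
have b1 : 0 < `|b| by rewrite normr_gt0.
by rewrite -(ler_pM2r b1) -expr2 -cnorm_star cnormM.
Qed.

Lemma ipDl x y z : ip (x + y) z = ip x z + ip y z.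
Proof. by rewrite -ip_star ipDr cstarD !ip_star. Qed.

Lemma ipZl c x y : ip (c *: x) y = c^* *: ip x y.
Proof. by rewrite -ip_star ipZr cstarZ ip_star. Qed.

Lemma ipNl x y : ip (- x) y = - ip x y.
Proof. by rewrite -scaleN1r ipZl rmorphN rmorph1 scaleN1r. Qed.

Lemma ipNr x y : ip x (- y) = - ip x y.
Proof. by rewrite -scaleN1r ipZr scaleN1r. Qed.

Lemma norm_act x (a : A) : `|act x a| <= `|x| * `|a|.
Proof.
rewrite -(@ler_pXn2r _ 2)// ?nnegrE ?mulr_ge0//.
rewrite exprMn ip_norm ip_actr -ip_star ip_actr cstarM ip_star.
apply: le_trans (cnormM _ _) _; rewrite [`|a| ^+ 2]expr2 mulrA.
rewrite ler_wpM2r//; apply: le_trans (cnormM _ _) _.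
by rewrite -ip_norm cnormJ mulrC.
Qed.

(* The triangle inequality is part of the structure, so polarization gives
   Cauchy-Schwarz up to a constant with no positivity argument in [A]. *)
Lemma norm_ip x y : `|ip x y| <= 4 * (`|x| * `|y|).
Proof.
have polar (u v : E) : 4 *: ip u v =
    ip (u + v) (u + v) - ip (u - v) (u - v)
    + ('i *: ip (u - 'i *: v) (u - 'i *: v)
       - 'i *: ip (u + 'i *: v) (u + 'i *: v)).
  have cross (w : E) : ip (u + w) (u + w) - ip (u - w) (u - w) =
      2 *: (ip u w + ip w u).
    rewrite !ipDl !ipDr !ipNl !ipNr opprK !opprD !opprK scaler_nat mulr2n.
    rewrite addrACA [X in X + _]addrACA [X in _ + X]addrACA !subrr add0r addr0.
    by rewrite addrACA.
  rewrite cross -scalerBr -opprB cross ipZl ipZr conjCi scaleNr.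
  rewrite -scalerBr scalerN !scalerA mulrAC -expr2 sqrCi mulN1r scaleNr opprK.
  rewrite -scalerDr addrACA subrr addr0 -mulr2n -[ip u v *+ 2]scaler_nat scalerA.
  by rewrite -natrM.
have unit (u v : E) : `|u| = 1 -> `|v| = 1 -> `|ip u v| <= 4.
  move=> u1 v1.
  have le4 (w : E) : `|w| = 1 -> `|ip (u + w) (u + w)| <= 4.
    move=> w1; rewrite -ip_norm.
    have -> : 4 = 2 ^+ 2 :> R[i] by rewrite -natrX.
    rewrite ler_pXn2r ?nnegrE//.
    by rewrite (le_trans (ler_normD _ _))// u1 w1.
  rewrite -(@ler_pM2l _ 4)//.
  have -> : 4 * `|ip u v| = `|4 *: ip u v| by rewrite normrZ normr_nat.
  have -> : 4 * 4 = 4 + 4 + (4 + 4) :> R[i] by ring.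
  rewrite polar; apply: le_trans (ler_normD _ _) _.
  apply: lerD; apply: le_trans (ler_normB _ _) _.
    by rewrite lerD// le4// normrN.
  by rewrite !normrZ normCi !mul1r lerD ?le4 ?normrN ?normrZ ?normCi ?mul1r.
have [->|x0] := eqVneq x 0.
  by rewrite normr0 mul0r mulr0 -(scale0r (0 : E)) ipZl rmorph0 scale0r normr0.
have [->|y0] := eqVneq y 0.
  by rewrite normr0 !mulr0 -(scale0r (0 : E)) ipZr scale0r normr0.
have nz (z : E) : z != 0 -> `| `|z|^-1 *: z| = 1.
  by move=> z0; rewrite normrZ normfV normr_id mulVf ?normr_eq0.
have := unit _ _ (nz _ x0) (nz _ y0).
rewrite ipZl ipZr !normrZ norm_conjC !normfV !normr_id mulrA -invfM.
have xy0 : 0 < `|x| * `|y| by rewrite mulr_gt0 ?normr_gt0.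
by rewrite mulrC ler_pdivrMr.
Qed.

(** * Imaginary shifts of a symmetric operator *)

Lemma op_linB H : A_linear_op H -> forall x y, dom H x -> dom H y ->
  dom H (x - y) /\ H (x - y) = H x - H y.
Proof.
case=> _ Hlin _ x y Hx Hy.
by have := Hlin (-1) _ _ Hy Hx; rewrite !scaleN1r ![- _ + _]addrC.
Qed.

Lemma shiftB H c : A_linear_op H -> forall x y, dom H x -> dom H y ->
  dom H (x - y) /\ H (x - y) + c *: (x - y) = (H x + c *: x) - (H y + c *: y).
Proof.
move=> HL x y Hx Hy; have [? ->] := op_linB HL Hx Hy; split=> //.
by rewrite scalerBr opprD addrACA.
Qed.

Definition shift_onto H c := forall y, exists2 x, dom H x & H x + c *: x = y.

Section Symmetric.
Variable H : operator E.
Hypothesis Hsym : symmetric_op H.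
Let HL : A_linear_op H := Hsym.1.1.

Lemma ip_shift c x y : dom H x -> dom H y ->
  ip (H x + c *: x) y = ip x (H y + c^* *: y).
Proof. by move=> Hx Hy; rewrite ipDl ipDr ipZl ipZr Hsym.2. Qed.

(** The cross terms cancel: [ip (H x) x = ip x (H x)] enters with coefficients [c] and [c^* = - c],
    so both squares reduce to the same diagonal terms. *)
Lemma norm_shiftN c x : c^* = - c -> dom H x ->
  `|H x - c *: x| = `|H x + c *: x|.
Proof.
move=> cN Hx; apply/eqP; rewrite -(@eqrXn2 _ 2)// !ip_norm; apply/eqP.
have cN2 : (- c)^* = c by rewrite rmorphN/= cN opprK.
congr `|_|; rewrite -scaleNr !ipDl !ipDr !ipZl !ipZr cN2 cN.
rewrite (Hsym.2 _ _ Hx Hx) !scaleNr !addrA; congr (_ + _).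
  by rewrite addrNK addrK.
by rewrite scalerN.
Qed.

Lemma le_norm_shift c x : c^* = - c -> dom H x ->
  `|c| * `|x| <= `|H x + c *: x|.
Proof.
move=> cN Hx; rewrite -normrZ -(@ler_pM2l _ 2)//.
rewrite -[2 * `|c *: x|](_ : `|(H x + c *: x) - (H x - c *: x)| = _).
  by apply: le_trans (ler_normB _ _) _; rewrite norm_shiftN// mulr2n mulrDl mul1r.
by rewrite opprB addrC addrA addrNK -mulr2n normrMn mulr_natl.
Qed.

Lemma le_norm_op c x : c^* = - c -> dom H x -> `|H x| <= `|H x + c *: x|.
Proof.
move=> cN Hx; rewrite -(@ler_pM2l _ 2)//.
rewrite -[2 * `|H x|](_ : `|(H x + c *: x) + (H x - c *: x)| = _).
  by apply: le_trans (ler_normD _ _) _; rewrite norm_shiftN// mulr2n mulrDl mul1r.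
by rewrite addrACA subrr addr0 -mulr2n normrMn mulr_natl.
Qed.

(** [H + d] is [H + c] perturbed by [d - c], and [|c| |x| <= |H x + c x|] makes the relative bound
    1/2. *)
Lemma shift_onto_near c d : c^* = - c -> `|d - c| <= 2^-1 * `|c| ->
  shift_onto H c -> shift_onto H d.
Proof.
move=> cN dc Hc y.
have [|x z Hx Hz|x Hx|x Hx <-] := @surjective_perturbation _ E (dom H)
    (fun x => H x + c *: x) (fun x => (d - c) *: x) _ _ _ Hc y.
- exact: complex_bound.
- by have [? ?] := shiftB c HL Hx Hz; split=> //; rewrite scalerBr.
- rewrite normrZ; apply: le_trans (ler_wpM2r _ dc) _ => //.
  by rewrite -mulrA ler_wpM2l ?invr_ge0// le_norm_shift.
- by exists x; rewrite // -addrA -scalerDl [c + _]addrC subrK.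
Qed.

(** Consecutive rungs differ by [|c| / 2], and every rung has modulus at least [|c|], so each step
    can be taken upwards and downwards. *)
Lemma shift_onto_ladder c n : c^* = - c ->
  shift_onto H c <-> shift_onto H ((1 + n%:R / 2) * c).
Proof.
move=> cN.
have realk k : (1 + k%:R / 2 : R[i])^* = 1 + k%:R / 2.
  by rewrite rmorphD rmorph1 rmorphM fmorphV !rmorph_nat.
have kN k : ((1 + k%:R / 2) * c)^* = - ((1 + k%:R / 2) * c).
  by rewrite rmorphM/= realk cN mulrN.
have k1 k : `|c| <= `|(1 + k%:R / 2) * c|.
  by rewrite normrM ler_peMl// ger0_norm ?lerDl ?addr_ge0 ?divr_ge0//.
have stp k : `|(1 + k.+1%:R / 2) * c - (1 + k%:R / 2) * c| = 2^-1 * `|c|.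
  rewrite -mulrBl -natr1 normrM; congr (_ * _).
  rewrite (_ : _ - _ = 2^-1); last by field.
  by rewrite ger0_norm ?invr_ge0.
elim: n => [|n IH]; first by rewrite mul0r addr0 mul1r.
rewrite IH; split; apply: shift_onto_near => //.
  by rewrite stp ler_wpM2l ?invr_ge0.
by rewrite distrC stp ler_wpM2l ?invr_ge0.
Qed.
End Symmetric.

(** * Regularity and self-adjointness versus surjectivity of shifts *)

(** Two candidates differ by a [w] orthogonal to [dom H]; approximating [w] from this dense domain
    forces [ip w w = 0]. *)
Lemma adjointE H y z : densely_defined H -> adjoint_rel H y z -> adjoint H y = z.
Proof.
move=> [_ /dense_normP dH] yz.
have yw : adjoint_rel H y (adjoint H y) by apply: xgetPex; exists z.
apply/subr0_eq; set w := _ - z.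
have w0 x : dom H x -> ip x w = 0.
  by move=> Hx; rewrite ipDr ipNr -yw// -yz// subrr.
apply/eqP; rewrite -normr_eq0 -sqrf_eq0 ip_norm normr_eq0; apply/eqP.
(* The [+ 1] keeps the constant positive even if [w] vanishes. *)
apply: (@eq0_of_norm_lt_mul _ _ _ (4 * `|w| + 1)) => [|e e0].
  by rewrite ltr_wpDl// mulr_ge0.
have [x Hx wx] := dH w e e0.
have -> : ip w w = ip (w - x) w by rewrite [RHS]ipDl ipNl (w0 x Hx) subr0.
apply: le_lt_trans (norm_ip _ _) _; rewrite mulrCA mulrDr mulr1 ltr_pwDr//.
by rewrite ler_wpM2r ?mulr_ge0// ltW.
Qed.

Lemma self_adjoint_symmetric T : self_adjoint T -> symmetric_op T.
Proof.
move=> [dT [domT Tadj]]; split=> // x y Tx Ty.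
have yz : adjoint_rel T y (adjoint T y).
  by apply: xgetPex; move: Ty; rewrite domT.
by rewrite yz// Tadj.
Qed.

(** By [|x| <= |T x + c x|], approximate solutions lie close together and converge to some [l];
    closedness of the graph puts [(l, y - c l)] on it. *)
Lemma dense_shift_onto T c : symmetric_op T -> closed_op T ->
    c^* = - c -> `|c| = 1 ->
    dense ((fun x => T x + c *: x) @` dom T) -> shift_onto T c.
Proof.
move=> Tsym Tcl cN c1 /dense_normP dT y.
have TL := Tsym.1.1.
pose D (e : R[i]) := [set x | dom T x /\ `|y - (T x + c *: x)| < e / 2].
have [|||l lD] := @approx_limit _ E D.
- move=> d e de x [Tx h]; split=> //; apply: lt_le_trans h _.
  by rewrite ler_wpM2r// invr_ge0.
- move=> e e0; have [_ [x Tx <-] h] := dT y (e / 2) (divr_gt0 e0 (ltr0Sn _ 1)).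
  by exists x.
- move=> e x z e0 [Tx hx] [Tz hz].
  have [Txz Exz] := shiftB c TL Tx Tz.
  have := le_norm_shift Tsym cN Txz; rewrite c1 mul1r Exz => /le_lt_trans; apply.
  rewrite [e](_ : _ = e / 2 + e / 2); last by field.
  rewrite -(subrKA y) -[T x + _ - y]opprB [X in `|X|]addrC.
  apply: le_lt_trans (ler_normB _ _) _; exact: ltrD.
suff /Tcl [x Tx [xl Txl]] : closure ([set (x, T x) | x in dom T] : set (E * E))
    (l, y - c *: l).
  by exists x; rewrite // Txl xl subrK.
move=> B /nbhs_ballP[e /= e0 eB].
have [x [Tx hx] lx] := lD (e / 2) (divr_gt0 e0 (ltr0Sn _ 1)).
exists (x, T x); split; first by exists x.
apply: eB; split; rewrite /= -ball_normE /=.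
  by rewrite (lt_le_trans lx)// ler_pdivrMr// ler_peMr ?ler1n// ltW.
have -> : y - c *: l - T x = (y - (T x + c *: x)) - c *: (l - x).
  by rewrite scalerBr opprB opprD !addrA addrAC [RHS]addrAC subrK addrAC.
apply: le_lt_trans (ler_normB _ _) _; rewrite normrZ c1 mul1r.
rewrite [e](_ : _ = e / 2 + e / 2); last by field.
rewrite ltrD// (lt_le_trans hx)// ler_pdivrMr// ler_peMr ?ler1n//.
by rewrite divr_ge0// ltW.
Qed.

(** As [c^2 = -1], [1 + T^2 = (T + c)(T - c)]; the range of [T + c] thus contains the dense range of
    [1 + T^* T]. *)
Lemma regular_shift_onto T c : regular T -> self_adjoint T ->
  c^* = - c -> c * c = -1 -> shift_onto T c.
Proof.
move=> [dT Tcl _ dr] Tsa cN cc.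
have Tsym := self_adjoint_symmetric Tsa.
have [_ [domT Tadj]] := Tsa.
have c1 : `|c| = 1.
  by apply/eqP; rewrite -(@pexpr_eq1 _ _ 2)// expr2 -normrM cc normrN1.
apply: dense_shift_onto => //.
move=> O O0 oO; have [z [Oz [x [_ [Tx TTx]] xz]]] := dr O O0 oO.
exists z; split=> //.
have {}TTx : dom T (T x) by rewrite domT.
have [_ Tlin _] := dT.1.
have [Dz Ez] := Tlin (- c) _ _ Tx TTx.
exists (- c *: x + T x) => //.
rewrite -xz.
change (T (- c *: x + T x) + c *: (- c *: x + T x) =
  1 *: x + adjoint T (T x)).
rewrite Ez -(Tadj _ TTx) scale1r scalerDr scalerA mulrN cc opprK scale1r.
by rewrite scaleNr [x + _]addrC addrACA addNr add0r addrC.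
Qed.

Lemma symmetric_onto_regular H : symmetric_op H ->
  shift_onto H 'i -> shift_onto H (- 'i) -> regular H /\ self_adjoint H.
Proof.
move=> Hsym Hp Hm; have [dH symH] := Hsym; have HL := dH.1.
have iN : ('i : R[i])^* = - 'i by exact: conjCi.
have adjH y : dom H y -> adjoint_rel H y (H y) by move=> Hy x Hx; exact: symH.
(* Solve [(H - i) w = z - i y] with [w] in the domain. Then [y - w] is orthogonal to the range of
   [H + i], which is everything, so [y = w]. *)
have domadj y z : adjoint_rel H y z -> dom H y.
  move=> yz; have [w Hw Ew] := Hm (z - 'i *: y).
  suff -> : y = w by [].
  apply/subr0_eq/eqP; rewrite -normr_eq0 -sqrf_eq0 ip_norm normr_eq0.
  have [x Hx Ex] := Hp (y - w).
  rewrite -{1}Ex ipDr ipNr (ip_shift Hsym 'i Hx Hw) iN Ew.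
  by rewrite ipDl ipZl iN yz// ipDr ipNr ipZr scaleNr subrr.
have domE : dom H = dom (adjoint H).
  apply/seteqP; split=> y /=; first by move=> /adjH; exists (H y).
  by case=> z /domadj.
have Hsa : self_adjoint H.
  by split=> //; split=> // x Hx; rewrite (adjointE dH (adjH x Hx)).
split=> //; split=> //.
- move=> [x y] xy.
  have [w Hw Ew] := Hp (y + 'i *: x).
  suff -> : (x, y) = (w, H w) by exists w.
  (* A graph point [(z, H z)] within [e] of [(x, y)] satisfies [|z - w| <= |(H + i)(z - w)| < 2 e],
     whence the constant 3. *)
  have xw : x = w.
    apply/subr0_eq; apply: (@eq0_of_norm_lt_mul _ _ _ 3) => // e e0.
    have [_ [[z Hz <-] [/= xz yz]]] := xy _ (nbhsx_ballx (x, y) e e0).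
    rewrite -ball_normE /= in xz; rewrite -ball_normE /= in yz.
    have [Hzw Ezw] := shiftB 'i HL Hz Hw.
    rewrite -(subrKA z) [e * 3](_ : _ = e + (e + e)); last by ring.
    apply: le_lt_trans (ler_normD _ _) _; apply: ltrD => //.
    have := le_norm_shift Hsym iN Hzw; rewrite normCi mul1r => /le_lt_trans; apply.
    rewrite Ezw Ew opprD addrACA -scalerBr -normrN opprD opprB -scalerN opprB.
    by apply: le_lt_trans (ler_normD _ _) _; rewrite normrZ normCi mul1r ltrD.
  by rewrite xw in Ew *; move/addIr: Ew => ->.
- by rewrite -domE; exact: dH.2.
(* The range of [1 + H^* H] is all of [E]: solving [(H + i) u = y], then [(H - i) v = u], gives
   [(1 + H^2) v = y]. *)
- move=> O [y Oy] _; exists y; split=> //.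
  have [u Hu Eu] := Hp y; have [v Hv Ev] := Hm u.
  have HHv : dom H (H v).
    have -> : H v = 'i *: v + u by rewrite -Ev addrC scaleNr subrK.
    by have [_ Hlin _] := HL; apply: (Hlin _ _ _ Hv Hu).1.
  exists v; first by split=> //; split=> //; rewrite -domE.
  change (1 *: v + adjoint H (H v) = y); rewrite -Hsa.2.2// scale1r -Eu.
  have -> : u = - 'i *: v + H v by rewrite -Ev addrC.
  have [_ Hlin _] := HL; rewrite (Hlin _ _ _ Hv HHv).2 scalerDr scalerA.
  rewrite mulrN -expr2 sqrCi opprK scale1r scaleNr.
  by rewrite [v + 'i *: _]addrC [RHS]addrACA addNr add0r addrC.
Qed.

(** * Smallness relative to large imaginary shifts *)

(** The relative bound of [f] tends to zero along exactly the shifts that [shift_onto_ladder]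
    reaches from ['i]. *)
Definition eventually_small T (f : E -> R[i]) := forall e : R[i], 0 < e ->
  \forall n \near \oo, forall x, dom T x ->
    `|f x| <= e * `|T x + ((1 + n%:R / 2) * 'i) *: x|.

Lemma eventually_smallD T f g : eventually_small T f -> eventually_small T g ->
  eventually_small T (fun x => f x + g x).
Proof.
move=> sf sg e e0; have e20 : 0 < e / 2 by rewrite divr_gt0.
apply: filterS2 (sf _ e20) (sg _ e20) => n fn gn x Tx.
rewrite [e](_ : _ = e / 2 + e / 2); last by field.
by rewrite mulrDl (le_trans (ler_normD _ _))// lerD ?fn ?gn.
Qed.

Lemma eventually_small_le T (b : R[i]) f g : 0 <= b ->
  (forall x, dom T x -> `|g x| <= b * `|f x|) ->
  eventually_small T f -> eventually_small T g.
Proof.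
move=> b0 gf sf e e0; have b1 : 0 < b + 1 by rewrite ltr_wpDl.
apply: filterS (sf _ (divr_gt0 e0 b1)) => n fn x Tx.
apply: le_trans (gf _ Tx) _; apply: le_trans (ler_wpM2l b0 (fn _ Tx)) _.
rewrite mulrA ler_wpM2r// mulrCA ler_piMr ?(ltW e0)//.
by rewrite ler_pdivrMr// mul1r lerDl.
Qed.

Section Shift.
Variables (T : operator E) (n : nat).
Hypothesis Tsym : symmetric_op T.
Let m : R[i] := 1 + n%:R / 2.

Lemma shift_real_gt0 : 0 < m.
Proof. by rewrite ltr_wpDr// divr_ge0. Qed.

Lemma conj_shift (c : R[i]) : c^* = - c -> (m * c)^* = - (m * c).
Proof.
move=> cN; rewrite rmorphM/= rmorphD rmorph1 rmorphM/= fmorphV !rmorph_nat.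
by rewrite cN mulrN.
Qed.

Lemma le_norm_shift_large x : dom T x -> m * `|x| <= `|T x + (m * 'i) *: x|.
Proof.
move=> Tx; apply: le_trans (le_norm_shift Tsym (conj_shift (conjCi _)) Tx).
by rewrite normrM normCi mulr1 gtr0_norm// shift_real_gt0.
Qed.

(** Both [|T x|] and [|x|] are at most the norm on the right, since [m >= 1]; the factor 2 does not
    depend on [n]. *)
Lemma le_norm_shifti x : dom T x ->
  `|T x + 'i *: x| <= 2 * `|T x + (m * 'i) *: x|.
Proof.
move=> Tx; apply: le_trans (ler_normD _ _) _; rewrite mulr2n mulrDl mul1r.
apply: lerD.
  exact: (le_norm_op Tsym (conj_shift (conjCi _)) Tx).
rewrite normrZ normCi mul1r; apply: le_trans (le_norm_shift_large Tx).
by rewrite ler_peMl// lerDl divr_ge0.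
Qed.
End Shift.

Lemma eventually_small_ip T y : symmetric_op T ->
  eventually_small T (fun x => `|ip y (T x + 'i *: x)|).
Proof.
move=> Tsym e e0; have /dense_normP dT := Tsym.1.2.
(* The factor 4 of [norm_ip] and the factor 2 of [le_norm_shifti] turn [e / 16] into [e / 2]. *)
have [z Tz yz] := dT y (e / 16) (divr_gt0 e0 (ltr0Sn _ 15)).
set b := `|T z - 'i *: z|.
(* Moving [T + i] onto [z] leaves at most [4 b |x| <= 4 b N / m], which is at most [e / 2 * N] once
   [m >= 8 b / e]. *)
apply: filterS (complex_archimedean (8 * b / e)) => n.
have b0 : 0 <= b by exact: normr_ge0.
rewrite [`|_ / _|]ger0_norm ?divr_ge0 ?mulr_ge0 ?(ltW e0)//.
rewrite ler_pdivrMr// => bn x Tx.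
have m0 := shift_real_gt0 n; set m := 1 + n%:R / 2 in bn m0 *.
have h1 := le_norm_shift_large n Tsym Tx; rewrite -/m in h1.
have h2 := le_norm_shifti n Tsym Tx; rewrite -/m in h2.
set N := `|T x + (m * 'i) *: x| in h1 h2 *.
have N0 : 0 <= N by exact: normr_ge0.
rewrite normr_id -(subrK z y) ipDl.
rewrite [e](_ : _ = e / 2 + e / 2); last by field.
rewrite mulrDl; apply: le_trans (ler_normD _ _) _; apply: lerD.
  apply: le_trans (norm_ip _ _) _.
  rewrite [e / 2 * N](_ : _ = 4 * (e / 16 * (2 * N))); last by field.
  by rewrite ler_wpM2l// ler_pM// ltW.
have -> : ip z (T x + 'i *: x) = ip (T z - 'i *: z) x.
  by rewrite -scaleNr (ip_shift Tsym (- 'i) Tz Tx) rmorphN/= conjCi opprK.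
apply: le_trans (norm_ip _ _) _; rewrite -/b.
rewrite -(ler_pM2l m0).
rewrite [X in X <= _](_ : _ = 4 * b * (m * `|x|)); last by ring.
rewrite [X in _ <= X](_ : _ = m * e / 2 * N); last by ring.
rewrite ler_pM ?mulr_ge0 ?(ltW m0)//.
by rewrite ler_pdivlMr// (le_trans _ bn)// mulrAC -natrM.
Qed.

Lemma eventually_small_theta_span T F : symmetric_op T -> theta_span F ->
  eventually_small T (fun x => `|F (T x + 'i *: x)|).
Proof.
move=> Tsym [k [a [psi [eta FE]]]].
have small_seq (s : seq 'I_k) : eventually_small T
    (fun x => \sum_(i <- s) `|a i *: theta (psi i) (eta i) (T x + 'i *: x)|).
  elim: s => [|i s IH].
    move=> e e0; apply: nearW => n x _.
    by rewrite big_nil normr0 mulr_ge0// ltW.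
  under eq_fun do rewrite big_cons.
  apply: eventually_smallD IH.
  apply: (@eventually_small_le _ (`|a i| * `|psi i|))
    (eventually_small_ip (eta i) Tsym).
    by rewrite mulr_ge0.
  by move=> x Tx; rewrite !normr_id normrZ -mulrA ler_wpM2l// norm_act.
apply: eventually_small_le (small_seq (index_enum _)) => [|x Tx]; first exact: ler01.
rewrite mul1r normr_id FE (le_trans (ler_norm_sum _ _ _))//.
by rewrite ger0_norm// sumr_ge0.
Qed.

(** With [K = S (T + i)^-1], [S x = K ((T + i) x)]; a finite-rank [F] near [K] leaves an error
    controlled by [le_norm_shifti]. *)
Lemma relatively_compact_small T S : symmetric_op T -> relatively_compact T S ->
  eventually_small T (fun x => `|S x|).
Proof.
move=> Tsym [_ TS [_ cK] _] e e0.
have [F Fspan KF] := cK (e / 4) (divr_gt0 e0 (ltr0Sn _ 3)).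
have Fsmall := eventually_small_theta_span Tsym Fspan.
apply: filterS (Fsmall (e / 2) (divr_gt0 e0 (ltr0Sn _ 1))) => n Fn x Tx.
(* The preimage chosen by [inv_op] is [x] itself, as the lower bound for [T + i] makes it
   injective. *)
have invT : inv_op (add_op T (scalar_op E 'i)) (T x + 'i *: x) = x.
  apply: xget_unique; first by split.
  move=> z [[Tz _] /= zx]; apply/subr0_eq/eqP; rewrite -normr_le0.
  have [Tzx Ezx] := shiftB 'i Tsym.1.1 Tz Tx.
  have := le_norm_shift Tsym (conjCi _) Tzx.
  by rewrite Ezx zx subrr normr0 normCi mul1r.
have := KF (T x + 'i *: x).
rewrite -[comp_op S _ _]/(S (inv_op (add_op T (scalar_op E 'i)) _)) invT => SF.
rewrite normr_id -(subrK (F (T x + 'i *: x)) (S x)).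
apply: le_trans (ler_normD _ _) _.
rewrite [e](_ : _ = e / 2 + e / 2); last by field.
rewrite mulrDl; apply: lerD; last by have := Fn x Tx; rewrite normr_id.
apply: le_trans SF _.
set N := `|_ + ((1 + _) * 'i) *: x|.
rewrite [e / 2 * N](_ : _ = e / 4 * (2 * N)); last by field.
by rewrite ler_wpM2l ?le_norm_shifti// divr_ge0// ltW.
Qed.
End HilbertModule.

(** * Stability of regularity and self-adjointness *)

Theorem propositionA7 (R : realType) (A : cstarAlgType R) (E : hilbertModType A)
    (T S : operator E) :
  regular T -> self_adjoint T ->
  symmetric_op S -> relatively_compact T S ->
  regular (add_op T S) /\ self_adjoint (add_op T S) /\
  dom (add_op T S) = dom T.
Proof.
move=> Treg Tsa [[SL _] Ssym] TS.
have Tsym := self_adjoint_symmetric Tsa.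
have [TL dT] := Tsym.1.
have subTS : dom T `<=` dom S by case: TS.
have domE : dom (add_op T S) = dom T by apply/setIidl.
have Hsym : symmetric_op (add_op T S).
  split; last first.
    by move=> x y [Tx Sx] [Ty Sy]; rewrite /= ipDl ipDr Tsym.2// Ssym.
  split; last by rewrite domE.
  have [[T0 Tlin Tact] [S0 Slin Sact]] := (TL, SL).
  split=> [//|c x y [Tx Sx] [Ty Sy]|x a [Tx Sx]].
    have [[TD TE] [SD SE]] := (Tlin c _ _ Tx Ty, Slin c _ _ Sx Sy).
    by split=> //=; rewrite TE SE scalerDr addrACA.
  have [[TD TE] [SD SE]] := (Tact _ a Tx, Sact _ a Sx).
  by split=> //=; rewrite TE SE actDl.
have half0 : 0 < 2^-1 :> R[i] by rewrite invr_gt0.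
have [n Sn] := filter_ex (relatively_compact_small Tsym TS half0).
set m : R[i] := 1 + n%:R / 2 in Sn.
(* Used for [c = 'i] and [c = - 'i]: the ladder for [T] climbs to [m * c], [S] is added there with
   relative bound 1/2, and the ladder for [T + S] descends to [c]. The last premise transfers the
   bound, known at [m * 'i], to [m * c]. *)
have onto c : c^* = - c -> c * c = -1 ->
    (forall x, dom T x -> `|T x + (m * c) *: x| = `|T x + (m * 'i) *: x|) ->
    shift_onto (add_op T S) c.
  move=> cN cc cE; apply/(shift_onto_ladder Hsym n cN) => y.
  have Tonto := regular_shift_onto Treg Tsa cN cc.
  have Tm := (shift_onto_ladder Tsym n cN).1 Tonto.
  have [||x Tx|x Tx <-] := @surjective_perturbation _ E (dom T)
    (fun x => T x + (m * c) *: x) S _ _ _ Tm y.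
  - exact: complex_bound.
  - move=> x z Tx Tz; have [? ?] := shiftB (m * c) TL Tx Tz.
    by have [_ ?] := op_linB SL (subTS _ Tx) (subTS _ Tz).
  - by rewrite cE// -[`|S x|]normr_id Sn.
  by exists x; [rewrite domE|rewrite /= addrAC].
have sq : ('i : R[i]) * 'i = -1 by rewrite -expr2 sqrCi.
have iN : ('i : R[i])^* = - 'i by exact: conjCi.
rewrite -and_assoc; split; last exact: domE.
apply: symmetric_onto_regular => //.
  by apply: onto.
apply: onto => [||x Tx].
- by rewrite rmorphN/= iN.
- by rewrite mulrNN.
by rewrite mulrN scaleNr norm_shiftN// conj_shift.
Qed.
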